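(* Let $G=(V,E,\omega)$ be a finite undirected connected weighted graph, let $\emptyset\neq U\subseteq V$, let $m\geq 1$ and let $g\colon U\to\mathbb{R}^m$. For $p\in\mathbb{N}$ let $u_p\colon V\to\mathbb{R}^m$ be an extension of $g$ (i.e. $u_p=g$ on $U$) minimizing $$I_p(u)=\sum_{x\in V\setminus U}(Su(x))^p$$ among all $u\colon V\to\mathbb{R}^m$ with $u=g$ on $U$. Then $(u_p)_p$ converges (pointwise on $V$) to the unique tight extension $u$ of $g$ as $p\to\infty$.
   Context: $G=(V,E,\omega)$ is a finite undirected connected weighted graph with symmetric weights $\omega(x,y)\in[0,1]$, where $\omega(x,y)=0$ if and only if $(x,y)\notin E$; write $x\sim y$ iff $(x,y)\in E$. $|\cdot|$ is the Euclidean norm. For $u\colon V\to\mathbb{R}^m$ and $x\in V$ the local Lipschitz constant is $Su(x)=\max_{y\sim x}\sqrt{\omega(x,y)}\,|u(y)-u(x)|$. For $u,v\colon V\to\mathbb{R}^m$ with $u|_U=v|_U$, $u$ is called tighter than $v$ if $$\max\{Sv(x): x\in V\setminus U,\ Su(x)<Sv(x)\}>\max\{Su(x): x\in V\setminus U,\ Sv(x)<Su(x)\},$$ where the maximum over the empty set is $0$. A function $u$ is called tight if there is no $v\colon V\to\mathbb{R}^m$ with $v|_U=u|_U$ that is tighter than $u$. For each $g\colon U\to\mathbb{R}^m$ there is exactly one tight $u\colon V\to\mathbb{R}^m$ with $u|_U=g$, called the tight extension of $g$. *)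

(* Defs.v *)
From HB Require Import structures.
From mathcomp Require Import all_boot all_order all_algebra.
From mathcomp Require Import all_classical all_reals all_analysis.

Set Implicit Arguments.
Unset Strict Implicit.
Unset Printing Implicit Defensive.

Import Order.TTheory GRing.Theory Num.Theory.
Import numFieldNormedType.Exports.

Local Open Scope classical_set_scope.
Local Open Scope ring_scope.

(* Loops are not excluded; they contribute 0 to [lip] below. *)
Record weighted_graph (R : realType) (V : finType) := WeightedGraph {
  edge : rel V;
  weight : V -> V -> R;
  weight_sym : forall x y, weight x y = weight y x;
  weight_itv : forall x y, 0 <= weight x y <= 1;
  weight_eq0 : forall x y, weight x y = 0 <-> ~~ edge x y;
  edge_connected : forall x y, connect edge x y }.

(* The library norm `|v| on 'rV[R]_m is the sup norm, not the Euclidean one. *)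
Definition enorm (R : realType) (m : nat) (v : 'rV[R]_m) : R :=
  Num.sqrt (\sum_(i < m) v 0 i ^+ 2).

Section Tight.
Context (R : realType) (V : finType) (G : weighted_graph R V) (m : nat).
Implicit Types (U : {set V}) (u v : V -> 'rV[R]_m) (x y : V).

(* All maxima below are of nonnegative quantities, so that the default value 0
   only matters when the index set is empty. *)
Definition lip u x : R :=
  \big[Num.max/0]_(y | edge G x y) (Num.sqrt (weight G x y) * enorm (u y - u x)).

(* Largest value of [lip v] among the points outside [U] where it exceeds
   [lip u]. *)
Definition max_excess U u v : R :=
  \big[Num.max/0]_(x | (x \notin U) && (lip u x < lip v x)) lip v x.

Definition tighter U u v : Prop :=
  {in U, u =1 v} /\ max_excess U u v > max_excess U v u.

Definition tight U u : Prop := ~ exists v, tighter U v u.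

Definition extension U (g : {x | x \in U} -> 'rV[R]_m) u : Prop :=
  forall x : {x | x \in U}, u (val x) = g x.

Definition tight_extension U (g : {x | x \in U} -> 'rV[R]_m) u : Prop :=
  extension g u /\ tight U u.

Definition energy U (p : nat) u : R := \sum_(x | x \notin U) lip u x ^+ p.

Definition energy_minimizer U (g : {x | x \in U} -> 'rV[R]_m) (p : nat) u :
    Prop :=
  extension g u /\ forall v, extension g v -> energy U p u <= energy U p v.

End Tight.

(* Main.v *)
Require Import Defs.
From HB Require Import structures.
From mathcomp Require Import all_boot all_order all_algebra.
From mathcomp Require Import all_classical all_reals all_analysis.
From mathcomp Require Import ring lra.

Set Implicit Arguments.
Unset Strict Implicit.
Unset Printing Implicit Defensive.

Import Order.TTheory GRing.Theory Num.Theory.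
Import numFieldNormedType.Exports.

Local Open Scope classical_set_scope.
Local Open Scope ring_scope.

(** Write [S u x] for [lip G u x].  Everything rests on the strict convexity of
    the Euclidean norm.  Let [w] be the midpoint of two functions [u] and [v].
    On an edge from [x] where the increments of [u] and [v] differ, the increment
    of [w] is strictly smaller than [max (S u x) (S v x)]; where they agree, all
    three increments are equal.  Hence [S w x <= max (S u x) (S v x)], strictly
    if [S u x] and [S v x] differ.

    Uniqueness ([tight_unique]).  Let [u] and [v] be tight and equal on [U].  If
    [S u] and [S v] differed outside [U], the midpoint would be tighter than
    whichever of them is larger at the point of disagreement with the largest
    value; so [S u = S v] there.  Suppose that [D], the set where [u] and [v]
    differ, is nonempty.  It avoids [U], so by connectedness an edge leaves it.
    The increments of [u] and [v] differ on every edge between [D] and its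
    complement, so those edges are slack for [w].  Multiplying [w] by [1 - t] on
    [D], for a small [t > 0], shrinks the increments inside [D] and keeps the
    crossing edges slack: the result is tighter than [u], a contradiction.

    Limits of minimizers are tight ([limit_tight]).  Let [u] be the limit of
    [u_ p] along some filter finer than [\oo], and suppose that [v] is tighter
    than [u], with [M = S u x0] the value that witnesses it.  The competitor
    [z p = u_ p + (v - u) / 2] tends to the midpoint [w] of [u] and [v].  Where
    [S w < M], which includes [x0], [S (z p)] stays below a constant smaller than
    [M]; at the other points [S (z p) <= S (u_ p)] eventually, because each edge
    is either one on which [u] and [v] have the same increment, so that [z p] and
    [u_ p] have the same increment too, or a slack edge of [w].  For large [p]
    the energy gained at [x0] outweighs what is lost elsewhere, since every
    fixed multiple of [c ^ p] is eventually below [c' ^ p] when [0 <= c < c'], and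
    [z p] beats the minimizer [u_ p].

    Convergence.  The minimizers are bounded ([minimizers_bounded]), so they
    converge along every ultrafilter finer than [\oo].  Each of these limits is a
    tight extension, so by uniqueness they all coincide; this common value is the
    limit along [\oo] itself. *)

(** * Strict convexity of the Euclidean norm *)

Section EuclideanNorm.
Context (R : realType) (m : nat).
Implicit Types (a b : 'rV[R]_m) (c : R).

Lemma enorm_ge0 a : 0 <= enorm a.
Proof. exact: sqrtr_ge0. Qed.

Lemma sqr_enorm a : enorm a ^+ 2 = \sum_(i < m) a 0 i ^+ 2.
Proof. by rewrite sqr_sqrtr// sumr_ge0// => i _; rewrite sqr_ge0. Qed.

Lemma enorm_eq0 a : (enorm a == 0) = (a == 0).
Proof.
rewrite -(sqrf_eq0 (enorm a)) sqr_enorm psumr_eq0; last first.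
  by move=> i _; rewrite sqr_ge0.
apply/allP/eqP => [a0|-> i _]; last by rewrite mxE /= expr0n.
apply/rowP => i; rewrite mxE; apply/eqP; rewrite -sqrf_eq0.
exact: (a0 i (mem_index_enum i)).
Qed.

Lemma enormZ c a : enorm (c *: a) = `|c| * enorm a.
Proof.
rewrite /enorm -sqrtr_sqr -sqrtrM ?sqr_ge0// mulr_sumr.
by congr Num.sqrt; apply: eq_bigr => i _; rewrite mxE exprMn.
Qed.

Lemma normr_le_enorm a : `|a| <= enorm a.
Proof.
rewrite [leLHS]/Num.norm /= mx_normrE; apply/bigmax_leP; split.
  exact: enorm_ge0.
move=> [i j] _ /=; rewrite (ord1 i) -sqrtr_sqr ler_wsqrtr//.
rewrite (bigD1 j)//= lerDl sumr_ge0// => k _; exact: sqr_ge0.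
Qed.

(** The parallelogram identity. *)
Lemma enorm_midpoint a b :
  enorm (2^-1 *: (a + b)) ^+ 2 =
    (enorm a ^+ 2 + enorm b ^+ 2) / 2 - enorm (a - b) ^+ 2 / 4.
Proof.
rewrite !sqr_enorm -big_split/= !mulr_suml -sumrB.
by apply: eq_bigr => i _; rewrite !mxE; field.
Qed.

(** Strict convexity: the term [enorm (a - b) ^+ 2 / 4] of the parallelogram
    identity is positive. *)
Lemma enorm_midpoint_lt a b c :
  enorm a <= c -> enorm b <= c -> a != b -> enorm (2^-1 *: (a + b)) < c.
Proof.
move=> ac bc ab; have c0 : 0 <= c := le_trans (enorm_ge0 a) ac.
have ab0 : 0 < enorm (a - b).
  by rewrite lt_neqAle enorm_ge0 andbT eq_sym enorm_eq0 subr_eq0.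
rewrite -(ltr_pXn2r (n := 2))// ?nnegrE ?enorm_ge0// enorm_midpoint.
have a2 : enorm a ^+ 2 <= c ^+ 2 by rewrite lerXn2r// nnegrE ?enorm_ge0.
have b2 : enorm b ^+ 2 <= c ^+ 2 by rewrite lerXn2r// nnegrE ?enorm_ge0.
have := exprn_gt0 2 ab0; lra.
Qed.

Lemma cvg_enorm (T : Type) (F : set_system T) (FF : Filter F)
    (f : T -> 'rV[R]_m) a :
  f t @[t --> F] --> a -> enorm (f t) @[t --> F] --> enorm a.
Proof.
move=> fa; apply: (continuous_cvg _ (@sqrt_continuous R _)).
apply: (cvg_big (op := +%R)); first exact: add_continuous.
move=> i _; apply: (continuous_cvg _ (@exprn_continuous R 2 _)).
exact: (continuous_cvg _ (@coord_continuous R 1 m 0 i a)).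
Qed.

End EuclideanNorm.

(** * Local Lipschitz constants of midpoints *)

Section LocalLipschitz.
Context (R : realType) (V : finType) (G : weighted_graph R V) (m : nat).
Implicit Types (u v w : V -> 'rV[R]_m) (x y : V) (U : {set V}).

Definition edge_lip u x y : R :=
  Num.sqrt (weight G x y) * enorm (u y - u x).

Definition midpoint u v : V -> 'rV[R]_m := fun x => 2^-1 *: (u x + v x).

Lemma midpoint_id u v x : u x = v x -> midpoint u v x = u x.
Proof.
move=> uv; rewrite /midpoint -uv scalerDr -scalerDl.
by rewrite (_ : 2^-1 + 2^-1 = 1 :> R) ?scale1r//; field.
Qed.

Lemma sqrt_weight_gt0 x y : edge G x y -> 0 < Num.sqrt (weight G x y).
Proof.
move=> xy; rewrite sqrtr_gt0 lt_neqAle.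
have /andP[-> _] := weight_itv G x y; rewrite andbT eq_sym.
by apply/negP => /eqP /weight_eq0; rewrite xy.
Qed.

Lemma edge_lip_ge0 u x y : 0 <= edge_lip u x y.
Proof. by rewrite mulr_ge0 ?sqrtr_ge0. Qed.

Lemma lip_ge0 u x : 0 <= lip G u x.
Proof. exact: bigmax_ge_id. Qed.

Lemma edge_lip_le u x y : edge G x y -> edge_lip u x y <= lip G u x.
Proof. by move=> xy; apply: (bigmax_sup y). Qed.

Lemma lip_le u x c : 0 <= c ->
  (forall y, edge G x y -> edge_lip u x y <= c) -> lip G u x <= c.
Proof. by move=> c0 h; apply/bigmax_leP; split. Qed.

Lemma lip_lt u x c : 0 < c ->
  (forall y, edge G x y -> edge_lip u x y < c) -> lip G u x < c.
Proof. by move=> c0 h; apply/bigmax_ltP; split. Qed.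

Lemma edge_lip_midpoint_lt u v x y : edge G x y ->
  u y - u x != v y - v x ->
  edge_lip (midpoint u v) x y < Num.max (lip G u x) (lip G v x).
Proof.
move=> xy uv; have w0 := sqrt_weight_gt0 xy.
rewrite /edge_lip mulrC -ltr_pdivlMr//.
have -> : midpoint u v y - midpoint u v x
    = 2^-1 *: ((u y - u x) + (v y - v x)).
  by rewrite /midpoint -scalerBr; congr (_ *: _); rewrite opprD addrACA.
apply: enorm_midpoint_lt => //; rewrite ler_pdivlMr// mulrC le_max.
  by rewrite (edge_lip_le u xy).
by rewrite (edge_lip_le v xy) orbT.
Qed.

Lemma edge_lip_midpoint_eq u v x y : u y - u x = v y - v x ->
  edge_lip (midpoint u v) x y = edge_lip u x y.
Proof.
move=> uv; rewrite /edge_lip /midpoint -scalerBr opprD addrACA -uv.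
by rewrite scalerDr -scalerDl (_ : 2^-1 + 2^-1 = 1 :> R) ?scale1r//; field.
Qed.

Lemma lip_midpoint_le u v x :
  lip G (midpoint u v) x <= Num.max (lip G u x) (lip G v x).
Proof.
apply: lip_le => [|y xy]; first by rewrite le_max lip_ge0.
have [uv|uv] := eqVneq (u y - u x) (v y - v x).
  by rewrite edge_lip_midpoint_eq// le_max edge_lip_le.
exact/ltW/edge_lip_midpoint_lt.
Qed.

(** On an edge where the increments of [u] and [v] agree, their common length is
    bounded by both constants, hence by the smaller of the two. *)
Lemma lip_midpoint_lt u v x : lip G u x != lip G v x ->
  lip G (midpoint u v) x < Num.max (lip G u x) (lip G v x).
Proof.
move=> neq; have lt_min : Num.min (lip G u x) (lip G v x)
    < Num.max (lip G u x) (lip G v x).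
  by case: (ltgtP (lip G u x) (lip G v x)) neq.
apply: lip_lt => [|y xy].
  by apply: le_lt_trans lt_min; rewrite le_min !lip_ge0.
have [uv|uv] := eqVneq (u y - u x) (v y - v x); last first.
  exact: edge_lip_midpoint_lt.
apply: le_lt_trans lt_min; rewrite edge_lip_midpoint_eq// le_min.
by rewrite edge_lip_le//= /edge_lip uv edge_lip_le.
Qed.

Lemma cvg_edge_lip (T : Type) (F : set_system T) (FF : Filter F)
    (f : T -> V -> 'rV[R]_m) u x y :
  (forall z, f t z @[t --> F] --> u z) ->
  edge_lip (f t) x y @[t --> F] --> edge_lip u x y.
Proof.
move=> fu; apply: cvgM; first exact: cvg_cst.
by apply: cvg_enorm; apply: cvgB; exact: fu.
Qed.

Lemma cvg_lip (T : Type) (F : set_system T) (FF : Filter F)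
    (f : T -> V -> 'rV[R]_m) u x :
  (forall z, f t z @[t --> F] --> u z) ->
  lip G (f t) x @[t --> F] --> lip G u x.
Proof.
move=> fu; apply: (cvg_big (op := Num.max)) => [|y _]; last exact: cvg_edge_lip.
move=> p; apply: (@continuous_max R _ fst snd); first exact: cvg_fst.
exact: cvg_snd.
Qed.

(** This form has no maxima: a maximum exceeds another one if and only if one of
    its terms exceeds all the terms of the other. *)
Lemma tighterP U u v :
  tighter G U u v <->
  {in U, u =1 v} /\
  exists2 x0, x0 \notin U & lip G u x0 < lip G v x0 /\
    forall x, x \notin U -> lip G v x < lip G u x -> lip G u x < lip G v x0.
Proof.
split=> [[uv gt]|[uv [x0 Ux0 [lt0 H]]]]; split=> //.
  move: gt => /bigmax_gtP[|[x0 /andP[Ux0 lt0] H]].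
    by rewrite ltNge bigmax_ge_id.
  exists x0 => //; split=> // x Ux ltx; apply: le_lt_trans H.
  by apply: (bigmax_sup x); rewrite ?Ux.
apply: (@lt_le_trans _ _ (lip G v x0)); last first.
  by apply: (bigmax_sup x0); rewrite ?Ux0.
apply/bigmax_ltP; split=> [|x /andP[]]; last exact: H.
exact: le_lt_trans (lip_ge0 _ _) lt0.
Qed.

End LocalLipschitz.

(** * Uniqueness of tight functions *)

Section Uniqueness.
Context (R : realType) (V : finType) (G : weighted_graph R V) (m : nat).
Implicit Types (u v w : V -> 'rV[R]_m) (x y : V) (U D : {set V}).

(** Where [lip G u] and [lip G v] differ the midpoint stays strictly below their
    maximum, hence below [lip G v x0]; where they agree it does not exceed
    [lip G v].  So [x0] witnesses that the midpoint is tighter. *)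
Lemma midpoint_tighter U u v x0 : {in U, u =1 v} -> x0 \notin U ->
  lip G u x0 < lip G v x0 ->
  (forall x, x \notin U -> lip G u x != lip G v x ->
    Num.max (lip G u x) (lip G v x) <= lip G v x0) ->
  tighter G U (midpoint u v) v.
Proof.
move=> uv Ux0 lt0 max0; apply/tighterP; split.
  by move=> x Ux; rewrite midpoint_id uv.
exists x0 => //; split.
  have := lip_midpoint_lt (negbT (lt_eqF lt0)).
  by rewrite max_r// ltW.
move=> x Ux ltx; have neq : lip G u x != lip G v x.
  apply: contraTneq ltx => eqx.
  by have := lip_midpoint_le G u v x; rewrite eqx maxxx leNgt.
exact: lt_le_trans (lip_midpoint_lt neq) (max0 x Ux neq).
Qed.

(** Otherwise take the point of disagreement with the largest value: the midpoint
    is tighter than the function that attains this value. *)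
Lemma tight_lip_eq U u v : tight G U u -> tight G U v -> {in U, u =1 v} ->
  {in ~: U, lip G u =1 lip G v}.
Proof.
move=> tu tv uv x1; rewrite !inE => Ux1; apply: contrapT => /eqP neq1.
pose P x := (x \notin U) && (lip G u x != lip G v x).
pose M x := Num.max (lip G u x) (lip G v x).
have Px1 : P x1 by rewrite /P Ux1.
have [x0 /andP[Ux0 neq0] max0] :
    exists2 x0, P x0 & forall x, P x -> M x <= M x0.
  by case: (@arg_maxP _ _ _ x1 P M Px1) => x0; exists x0.
have {}max0 x : x \notin U -> lip G u x != lip G v x -> M x <= M x0.
  by move=> Ux neq; apply: max0; rewrite /P Ux.
have [lt0|gt0|/eqP] := ltgtP (lip G u x0) (lip G v x0).
- apply: tv; exists (midpoint u v); apply: (midpoint_tighter uv Ux0 lt0).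
  by move: max0; rewrite {2}/M max_r// ltW.
- apply: tu; exists (midpoint v u).
  apply: (midpoint_tighter _ Ux0 gt0) => [x Ux|x Ux neq]; first by rewrite uv.
  rewrite maxC; move: (max0 x Ux); rewrite eq_sym => /(_ neq).
  by rewrite /M [leRHS]max_l// ltW.
- by rewrite (negPf neq0).
Qed.

Definition contract D (t : R) w : V -> 'rV[R]_m :=
  fun x => if x \in D then (1 - t) *: w x else w x.

Lemma cvg_contract D w x : contract D t w x @[t --> 0^'+] --> w x.
Proof.
rewrite /contract; case: (x \in D); last exact: cvg_cst.
have : (1 - t) *: w x @[t --> (0 : R)^'+] --> (1 - 0) *: w x.
  by apply: cvgZr_tmp; apply: cvgB; [exact: cvg_cst|exact: cvg_within].
by rewrite subr0 scale1r.
Qed.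

Lemma exists_boundary_edge D x1 x2 : x1 \in D -> x2 \notin D ->
  exists x y, [/\ x \in D, y \notin D & edge G x y].
Proof.
move=> Dx1 Dx2; have /connectP[s] := edge_connected G x1 x2.
elim: s x1 Dx1 => [x1 Dx1 _ eq12|y s IHs x1 Dx1 /= /andP[xy sp] lasts].
  by rewrite eq12 Dx1 in Dx2.
have [Dy|Dy] := boolP (y \in D); first exact: IHs Dy sp lasts.
by exists x1, y.
Qed.

(** The midpoint [w] of [u] and [v], contracted on the set [D] where they differ,
    would be tighter than [u]. *)
Lemma tight_unique U u v : U != finset.set0 ->
  tight G U u -> tight G U v -> {in U, u =1 v} -> u =1 v.
Proof.
move=> /set0Pn[x2 Ux2] tu tv uv x1; apply: contrapT => /eqP neq1.
have lip_eq := tight_lip_eq tu tv uv.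
pose D := finset (fun x => u x != v x).
have Dx1 : x1 \in D by rewrite inE.
have UD x : x \in U -> x \notin D by move=> Ux; rewrite inE uv// eqxx.
have DU x : x \in D -> x \notin U by apply: contraTN => /UD.
have [x [y [Dx Dy xy]]] := exists_boundary_edge Dx1 (UD _ Ux2).
pose w := midpoint u v.
have w_le a : a \notin U -> lip G w a <= lip G u a.
  move=> Ua; have := lip_midpoint_le G u v a.
  by rewrite -lip_eq ?inE// maxxx.
(* The increments of [u] and [v] on an edge that crosses the boundary of [D]
   differ, so [w] is slack on it. *)
have w_lt a b : a \notin U -> edge G a b -> (a \in D) != (b \in D) ->
    edge_lip G w a b < lip G u a.
  move=> Ua ab; rewrite !inE => neqD.
  rewrite -[ltRHS]maxxx {2}lip_eq ?inE//; apply: edge_lip_midpoint_lt => //.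
  apply: contraNneq neqD => eqd; apply/eqP; congr (~~ _).
  apply/eqP/eqP => e; move: eqd; rewrite e; first exact: addIr.
  by move=> /addrI/oppr_inj.
(* The finitely many crossing edges stay slack for a small contraction. *)
have [t [t0 t1 Ht]] : exists t, [/\ 0 < t, t < 1 & forall a b,
    a \notin U -> edge G a b -> (a \in D) != (b \in D) ->
    edge_lip G (contract D t w) a b < lip G u a].
  suff : \forall t \near (0 : R)^'+, [/\ 0 < t, t < 1 & forall a b,
    a \notin U -> edge G a b -> (a \in D) != (b \in D) ->
    edge_lip G (contract D t w) a b < lip G u a] by move=> /filter_ex.
  near=> t; split.
  - near: t; exact: nbhs_right_gt.
  - near: t; exact: nbhs_right_lt.
  - near: t; apply: filter_forall => a; apply: filter_forall => b.
    have [[Ua ab neqD]|H] := pselect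
        [/\ a \notin U, edge G a b & (a \in D) != (b \in D)]; last first.
      by apply: nearW => t Ua ab neqD; case: H.
    near=> t; move=> _ _ _; near: t; apply: cvgr_lt (w_lt a b Ua ab neqD).
    by apply: cvg_edge_lip => z; exact: cvg_contract.
have inD a b : a \in D -> b \in D ->
    edge_lip G (contract D t w) a b = (1 - t) * edge_lip G w a b.
  move=> Da Db; rewrite /edge_lip /contract Da Db -scalerBr enormZ.
  by rewrite gtr0_norm ?subr_gt0// mulrCA.
have outD a b : a \notin D -> b \notin D ->
    edge_lip G (contract D t w) a b = edge_lip G w a b.
  by move=> /negPf Da /negPf Db; rewrite /edge_lip /contract Da Db.
apply: tu; exists (contract D t w); apply/tighterP; split.
  by move=> a Ua; rewrite /contract (negPf (UD _ Ua)) /w midpoint_id ?uv.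
have lipx0 : 0 < lip G u x.
  apply: le_lt_trans (edge_lip_ge0 G w x y) (w_lt _ _ (DU _ Dx) xy _).
  by rewrite Dx (negPf Dy).
(* The edge from [x] to [y] leaves [D] and is slack, so [lip G u x] is positive
   and the contraction makes the constant at [x] drop. *)
exists x; [exact: DU|split].
  apply: lip_lt => // b xb; have [Db|Db] := boolP (b \in D); last first.
    by apply: Ht => //; [exact: DU|rewrite Dx (negPf Db)].
  rewrite inD//; apply: (@le_lt_trans _ _ ((1 - t) * lip G u x)); last first.
    by rewrite gtr_pMl// ltrBlDr ltrDl.
  rewrite ler_wpM2l ?subr_ge0 ?(ltW t1)//.
  exact: le_trans (edge_lip_le w xb) (w_le _ (DU _ Dx)).
move=> a Ua; rewrite ltNge; case/negP; apply: lip_le => [|b ab].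
  exact: lip_ge0.
have wab : edge_lip G w a b <= lip G u a.
  exact: le_trans (edge_lip_le w ab) (w_le _ Ua).
have [Da|Da] := boolP (a \in D); have [Db|Db] := boolP (b \in D).
- rewrite inD//; apply: le_trans wab.
  by rewrite ler_piMl ?edge_lip_ge0// gerBl ltW.
- by apply/ltW/Ht; rewrite // Da (negPf Db).
- by apply/ltW/Ht; rewrite // Db (negPf Da).
- by rewrite outD.
Unshelve. all: by end_near.
Qed.
End Uniqueness.

(** * Limits of energy minimizers are tight *)

Section Minimizers.
Context (R : realType) (V : finType) (G : weighted_graph R V) (m : nat).
Context (U : {set V}) (g : {x | x \in U} -> 'rV[R]_m).
Implicit Types (u v w : V -> 'rV[R]_m) (x y : V).

Lemma extension_trans u v : extension g u -> {in U, u =1 v} -> extension g v.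
Proof. by move=> gu uv [x Ux]; rewrite -uv// (gu (exist _ x Ux)). Qed.

Lemma extension_eq u v : extension g u -> extension g v -> {in U, u =1 v}.
Proof.
by move=> gu gv x Ux; rewrite (gu (exist _ x Ux)) (gv (exist _ x Ux)).
Qed.

Lemma extension_exists : exists u, extension g u.
Proof.
exists (fun x => if insub x is Some z then g z else 0) => -[x Ux] /=.
by rewrite insubT.
Qed.

(** The gain at [x0] is at least [c' ^+ p - c ^+ p], and the loss at each other
    point at most [c ^+ p]. *)
Lemma energy_lt p u v x0 c c' : 0 <= c ->
  x0 \notin U -> lip G v x0 <= c -> c' <= lip G u x0 -> 0 <= c' ->
  (forall x, x \notin U -> lip G v x <= lip G u x \/ lip G v x <= c) ->
  #|V|%:R * c ^+ p < c' ^+ p ->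
  energy G U p v < energy G U p u.
Proof.
move=> c0 Ux0 vx0 ux0 c'0 vu cc'; rewrite /energy.
rewrite (bigD1 x0)//= [ltRHS](bigD1 x0)//=.
have H : \sum_(x | (x \notin U) && (x != x0)) lip G v x ^+ p <=
    \sum_(x | (x \notin U) && (x != x0)) (c ^+ p + lip G u x ^+ p).
  apply: ler_sum => x /andP[Ux _].
  have := exprn_ge0 p c0; have := exprn_ge0 p (lip_ge0 G u x).
  case: (vu x Ux) => h.
    have : lip G v x ^+ p <= lip G u x ^+ p by rewrite lerXn2r// nnegrE lip_ge0.
    lra.
  have : lip G v x ^+ p <= c ^+ p by rewrite lerXn2r// nnegrE lip_ge0.
  lra.
rewrite big_split/= in H.
have Hc : c ^+ p + \sum_(x | (x \notin U) && (x != x0)) c ^+ p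
    <= #|V|%:R * c ^+ p.
  rewrite mulr_natl -sumr_const -(bigD1 x0)//= big_mkcond/=.
  by apply: ler_sum => x _; case: ifP => // _; rewrite exprn_ge0.
have : lip G v x0 ^+ p <= c ^+ p by rewrite lerXn2r// nnegrE lip_ge0.
have : c' ^+ p <= lip G u x0 ^+ p by rewrite lerXn2r// nnegrE lip_ge0.
move: H Hc cc'; lra.
Qed.

Lemma exponential_gap (N c c' : R) : 0 <= c -> c < c' ->
  \forall p \near \oo, N * c ^+ p < c' ^+ p.
Proof.
move=> c0 cc'; have c'0 : 0 < c' by apply: le_lt_trans cc'.
have q1 : `|c / c'| < 1.
  by rewrite ger0_norm ?divr_ge0 ?(ltW c'0)// ltr_pdivrMr// mul1r.
have : N * (c / c') ^+ p @[p --> \oo] --> N * 0.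
  by apply: cvgM; [exact: cvg_cst|exact: cvg_expr].
rewrite mulr0 => /cvgr_lt /(_ _ ltr01); apply: filterS => p.
by rewrite expr_div_n mulrA ltr_pdivrMr ?exprn_gt0// mul1r.
Qed.

Context (u_ : nat -> V -> 'rV[R]_m).
Context (u_min : forall p, (1 <= p)%N -> energy_minimizer G g p (u_ p)).

Lemma limit_extension (F : set_system nat) (FF : ProperFilter F) u :
  F --> \oo -> (forall x, u_ p x @[p --> F] --> u x) -> extension g u.
Proof.
move=> Foo uu [x Ux] /=.
apply: (@cvg_unique _ (@norm_hausdorff _ _) _ _ _ _ (uu x)).
apply: cvg_near_cst.
suff : \forall p \near F, (1 <= p)%N.
  by apply: filterS => p /u_min[gu _]; exact: (gu (exist _ x Ux)).
by apply: Foo; exact: nbhs_infty_ge.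
Qed.

(** A function [v] tighter than [u] would yield competitors
    [u_ p + (v - u) / 2] of smaller energy than the minimizers [u_ p]. *)
Lemma limit_tight (F : set_system nat) (FF : ProperFilter F) u :
  F --> \oo -> (forall x, u_ p x @[p --> F] --> u x) -> tight G U u.
Proof.
move=> Foo uu [v /tighterP[vu [x0 Ux0 [lt0 Hv]]]].
pose w := midpoint u v.
pose z p x := u_ p x + 2^-1 *: (v x - u x).
have zw x : z p x @[p --> F] --> w x.
  have : z p x @[p --> F] --> u x + 2^-1 *: (v x - u x).
    by apply: cvgD; [exact: uu|exact: cvg_cst].
  suff -> : u x + 2^-1 *: (v x - u x) = w x by [].
  by apply/rowP => i; rewrite !mxE; field.
set M := lip G u x0 in lt0 Hv.
have M0 : 0 < M := le_lt_trans (lip_ge0 G v x0) lt0.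
(* [c0] is the largest value of [lip G w] below [M], and [c0 < c < c' < M]: [c]
   bounds [lip G (z p)] from above where [lip G w < M], and [c'] bounds
   [lip G (u_ p) x0] from below. *)
pose c0 := \big[Num.max/0]_(x | lip G w x < M) lip G w x.
have c0M : c0 < M by apply/bigmax_ltP.
have c00 : 0 <= c0 by exact: bigmax_ge_id.
pose c := c0 + (M - c0) / 3; pose c' := c0 + 2 * (M - c0) / 3.
have low x : lip G w x < M -> \forall p \near F, lip G (z p) x <= c.
  move=> wM; apply: (cvgr_le (lip G w x)).
    exact: cvg_lip.
  have : lip G w x <= c0 by apply: (bigmax_sup x).
  by rewrite /c; lra.
have wx0 : lip G w x0 < M.
  by have := lip_midpoint_lt (negbT (gt_eqF lt0)); rewrite max_l// ltW.
(* Here [lip G v x <= lip G u x], since [lip G w x] would be below [M] otherwise.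
   So on every edge [z p] has the increment of [u_ p], or [w] is slack and the
   strict inequality [edge_lip G w x y < lip G u x] passes to [z p] and [u_ p]. *)
have high x : x \notin U -> M <= lip G w x ->
    \forall p \near F, lip G (z p) x <= lip G (u_ p) x.
  move=> Ux Mw; have vx : lip G v x <= lip G u x.
    rewrite leNgt; apply/negP => ltx.
    have := lip_midpoint_lt (negbT (lt_eqF ltx)); rewrite max_r ?(ltW ltx)//.
    by move=> /(le_lt_trans Mw); rewrite ltNge ltW// Hv.
  have H : \forall p \near F, forall y, edge G x y ->
      edge_lip G (z p) x y <= lip G (u_ p) x.
    apply: filter_forall => y.
    have [xy|xy] := boolP (edge G x y); last by apply: nearW.
    have [uvxy|uvxy] := eqVneq (u y - u x) (v y - v x).
      apply: nearW => p _.
      suff -> : edge_lip G (z p) x y = edge_lip G (u_ p) x y by exact: edge_lip_le.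
      have e : v y - u y = v x - u x.
        by apply/rowP => i; move/rowP/(_ i): uvxy; rewrite !mxE; lra.
      by rewrite /edge_lip /z e opprD addrACA subrr addr0.
    have := edge_lip_midpoint_lt xy uvxy; rewrite max_l// => ltxy.
    pose a := (edge_lip G w x y + lip G u x) / 2.
    have zlt : \forall p \near F, edge_lip G (z p) x y < a.
      apply: (cvgr_lt (edge_lip G w x y)); first exact: cvg_edge_lip.
      by rewrite /a; move: ltxy; rewrite -/w; lra.
    have ugt : \forall p \near F, a < lip G (u_ p) x.
      apply: (cvgr_gt (lip G u x)); first exact: cvg_lip.
      by rewrite /a; move: ltxy; rewrite -/w; lra.
    by near=> p; move=> _; apply/ltW/(@lt_trans _ _ a); near: p.
  by apply: filterS H => p H; apply: lip_le => //; exact: lip_ge0.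
have gap : \forall p \near F, #|V|%:R * c ^+ p < c' ^+ p.
  by apply: Foo; apply: exponential_gap; rewrite /c /c'; lra.
have ux0 : \forall p \near F, c' <= lip G (u_ p) x0.
  by apply: (cvgr_ge (lip G u x0)); [exact: cvg_lip|rewrite -/M /c'; lra].
have p_gt0 : \forall p \near F, (1 <= p)%N by apply: Foo; exact: nbhs_infty_ge.
have zu : \forall p \near F, forall x, x \notin U ->
    lip G (z p) x <= lip G (u_ p) x \/ lip G (z p) x <= c.
  apply: filter_forall => x.
  have [Ux|Ux] := boolP (x \notin U); last exact: nearW.
  have [Mw|wM] := leP M (lip G w x).
    by apply: filterS (high x Ux Mw) => p; left.
  by apply: filterS (low x wM) => p; right.
have [p [p0 gapp ux0p zup zx0p]] : exists p, [/\ (1 <= p)%N,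
    #|V|%:R * c ^+ p < c' ^+ p, c' <= lip G (u_ p) x0,
    (forall x, x \notin U ->
      lip G (z p) x <= lip G (u_ p) x \/ lip G (z p) x <= c) &
    lip G (z p) x0 <= c].
  apply: (@filter_ex _ F); near=> p; split; near: p => //.
  exact: low.
have [gup minp] := u_min p0.
have gz : extension g (z p).
  apply: extension_trans gup _ => x Ux.
  by rewrite /z vu// subrr scaler0 addr0.
have := minp _ gz; rewrite leNgt => /negP; apply.
by apply: (energy_lt (x0 := x0) (c := c) (c' := c')) => //; rewrite /c /c'; lra.
Unshelve. all: by end_near.
Qed.

(** * Boundedness of the minimizers *)

(** The energy of [u_ p] is at most that of [v], itself at most
    [#|V|%:R * K ^+ p] where [K] bounds [lip G v]; and [#|V| <= #|V| ^ p]. *)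
Lemma lip_minimizer_le p v x : extension g v -> (1 <= p)%N -> x \notin U ->
  lip G (u_ p) x <= #|V|%:R * \big[Num.max/0]_y lip G v y.
Proof.
move=> gv p1 Ux; set K := \big[_/_]_y _.
have K0 : 0 <= K by exact: bigmax_ge_id.
rewrite -(ler_pXn2r (n := p))// ?nnegrE ?lip_ge0 ?mulr_ge0//.
apply: (@le_trans _ _ (energy G U p (u_ p))).
  rewrite /energy (bigD1 x)//= lerDl sumr_ge0// => a _.
  by rewrite exprn_ge0// lip_ge0.
apply: le_trans ((u_min p1).2 _ gv) _.
apply: (@le_trans _ _ (#|V|%:R * K ^+ p)); last first.
  have V0 : (0 < #|V|)%N by apply/card_gt0P; exists x.
  rewrite exprMn ler_wpM2r ?exprn_ge0// -natrX ler_nat.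
  by case: p p1 => // p _; rewrite expnS leq_pmulr// expn_gt0 V0.
rewrite mulr_natl -sumr_const /energy big_mkcond/=; apply: ler_sum => a _.
case: ifP => _; last by rewrite exprn_ge0.
by rewrite lerXn2r// ?nnegrE ?lip_ge0//; exact: le_bigmax.
Qed.

(** The values on [U] are prescribed and the increments along edges that meet the
    complement of [U] are bounded, so a bound propagates along a path from [U]. *)
Lemma minimizers_bounded x : U != finset.set0 ->
  exists b, forall p, (1 <= p)%N -> `|u_ p x| <= b.
Proof.
have [v gv] := extension_exists.
move=> /set0Pn[x1 Ux1].
have [s] := connectP (edge_connected G x x1).
elim: s x => [x _ /= eqx|y s IHs x /= /andP[xy sp] lasts].
  exists `|v x| => p /u_min[gu _].
  by rewrite (extension_eq gu gv)// -eqx.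
have [b ub] := IHs y sp lasts.
have [Ux|Ux] := boolP (x \in U).
  by exists `|v x| => p /u_min[gu _]; rewrite (extension_eq gu gv).
pose K := \big[Num.max/0]_a lip G v a.
exists (b + #|V|%:R * K / Num.sqrt (weight G x y)) => p p1.
rewrite -[u_ p x](subrK (u_ p y)) addrC; apply: le_trans (ler_normD _ _) _.
rewrite lerD ?ub// distrC; apply: le_trans (normr_le_enorm _) _.
rewrite ler_pdivlMr ?sqrt_weight_gt0// mulrC.
exact: le_trans (edge_lip_le _ xy) (lip_minimizer_le gv p1 Ux).
Qed.

End Minimizers.

(** * Convergence along ultrafilters *)

Lemma ultra_compact_cvg (S : Type) (T : topologicalType) (F : set_system S)
    (K : set T) (f : S -> T) : UltraFilter F -> compact K ->
  (\forall t \near F, K (f t)) -> exists l : T, f t @[t --> F] --> l.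
Proof.
move=> FU cK FK; have [l [_ cl]] := cK (f @ F) _ FK.
exists l => B Bl; have [//|FnB] := in_ultra_setVsetC (f @^-1` B) FU.
by have [y [/= nBy By]] := cl (~` B) B FnB Bl.
Qed.

(** If a neighbourhood [B] of [l] had its preimage outside [F], then [F] together
    with the complement of this preimage would extend to an ultrafilter, along
    which [f] would not tend to [l]. *)
Lemma cvg_ultra (S : Type) (T : topologicalType) (F : set_system S)
    (f : S -> T) (l : T) : Filter F ->
  (forall H, UltraFilter H -> F `<=` H -> f t @[t --> H] --> l) ->
  f t @[t --> F] --> l.
Proof.
move=> FF Hl B Bl; apply: contrapT => nFB.
pose E := within (~` (f @^-1` B)) F.
have EP : ProperFilter E.
  split; last exact: within_filter.
  rewrite /E /within /= => F0; apply: nFB; apply: filterS F0 => t nn.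
  exact: contrapT.
have [H [HU EH]] := ultraFilterLemma EP.
have FH : F `<=` H by move=> A FA; apply: EH; apply: filterS FA => t.
have HB : H (f @^-1` B) := Hl H HU FH B Bl.
have HnB : H (~` (f @^-1` B)) by apply: EH; exact: withinT.
by have [t [/= ]] := filter_ex (filterI HB HnB).
Qed.

(** * The convergence theorem *)

Theorem theorem5p29 (R : realType) (V : finType) (G : weighted_graph R V)
    (U : {set V}) (m : nat) (g : {x | x \in U} -> 'rV[R]_m)
    (u_ : nat -> V -> 'rV[R]_m) :
  U != finset.set0 -> (1 <= m)%N ->
  (forall p : nat, (1 <= p)%N -> energy_minimizer G g p (u_ p)) ->
  exists u : V -> 'rV[R]_m,
    unique (tight_extension G g) u /\
    forall x : V, u_ p x @[p --> \oo] --> u x.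
Proof.
move=> U0 _ u_min.
have ultra_limit (H : set_system nat) : UltraFilter H -> H --> \oo ->
    exists2 u, tight_extension G g u & forall x, u_ p x @[p --> H] --> u x.
  move=> HU Hoo; have lim x : exists l : 'rV[R]_m, u_ p x @[p --> H] --> l.
    have [b ub] := minimizers_bounded u_min x U0.
    apply: (ultra_compact_cvg (K := closed_ball_ Num.norm 0 b)).
      apply: bounded_closed_compact; last exact: closed_closed_ball_.
      exists b; split; first exact: num_real.
      move=> c bc y; rewrite /closed_ball_/= sub0r normrN => /le_trans; apply.
      exact: ltW.
    have : \forall p \near H, (1 <= p)%N by apply: Hoo; exact: nbhs_infty_ge.
    by apply: filterS => p /ub; rewrite /closed_ball_/= sub0r normrN.
  have [u uu] := choice lim; exists u => //; split.
    exact: (limit_extension u_min _ Hoo uu).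
  exact: (limit_tight u_min _ Hoo uu).
have tight_eq u v : tight_extension G g u -> tight_extension G g v -> u = v.
  move=> [gu tu] [gv tv]; apply/funext.
  by apply: tight_unique U0 tu tv _; exact: extension_eq gu gv.
have [H0 [H0U H0oo]] := @ultraFilterLemma nat \oo _.
have [u tu _] := ultra_limit H0 H0U H0oo.
exists u; split=> [|x]; first by split=> // v; exact: tight_eq.
apply: cvg_ultra => H HU Hoo; have [v tv vv] := ultra_limit H HU Hoo.
by rewrite (tight_eq u v).
Qed.
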